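(* Let $P(x)=a_nx^n+\cdots+a_1x+a_0$ be a polynomial of degree $n$ with complex coefficients ($a_n\ne0$), and let $r_1,\ldots,r_n$ be its complex roots listed with multiplicity. Then for every integer $m$ with $0\le m\le n$, $$\frac{a_{n-m}}{a_n}=\sum_{\substack{(y_1,\ldots,y_m)\\ \sum i y_i=m}}\prod_{i=1}^{m}\frac{(-1)^{y_i}}{y_i!}\left(\frac1i\sum_{N=1}^{n}(r_N)^i\right)^{y_i},$$ where the sum runs over all partitions of $m$.
   Context: A partition of $m$ is represented by the tuple $(y_1,\ldots,y_m)$ of non-negative integers with $\sum_{i=1}^m i\,y_i=m$. For $m=0$ there is exactly one partition, the empty one. Empty products equal $1$ and $0^0=1$. *)

(* Defs.v *)
From mathcomp Require Export all_boot all_order all_algebra.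
From mathcomp Require Export reals complex.
Set Implicit Arguments.
Unset Strict Implicit.
Unset Printing Implicit Defensive.
Import GRing.Theory.

(* A partition of m is the tuple (y_1, ..., y_m) of its multiplicities, with
   \sum_i i * y_i = m. The ordinal i : 'I_m stands for the part i.+1. The
   values are bounded by m only so that the type is finite: the lemma
   partitions_complete shows that this excludes no partition. *)
Definition partitions (m : nat) : {set {ffun 'I_m -> 'I_m.+1}} :=
  [set y : {ffun 'I_m -> 'I_m.+1} | \sum_(i < m) i.+1 * y i == m].

Lemma partitions_complete (m : nat) (g : 'I_m -> nat) :
  \sum_(i < m) i.+1 * g i = m ->
  exists2 y, y \in partitions m & forall i, y i = g i :> nat.
Proof.
move=> sg.
have gm i : g i <= m.
  have : i.+1 * g i <= \sum_(j < m) j.+1 * g j.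
    by rewrite (bigD1 i) //= leq_addr.
  by rewrite sg; apply: leq_trans; rewrite leq_pmull.
exists [ffun i => inord (g i)]; last by move=> i; rewrite ffunE inordK ?ltnS.
rewrite inE; apply/eqP; rewrite -[RHS]sg.
by apply: eq_bigr => i _; rewrite ffunE inordK ?ltnS.
Qed.

Local Open Scope ring_scope.

Definition roots_with_multiplicity (F : fieldType) (n : nat)
    (P : {poly F}) (r : n.-tuple F) : Prop :=
  forall z : F, count_mem z r = mup z P.

(* Main.v *)
Require Import Defs.
From mathcomp Require Import all_boot all_order all_algebra.
From mathcomp Require Import reals complex.

(** With p_i the i-th power sum of the roots r_N, the identity is the
    coefficient of X^m in
      prod_N (1 - r_N X) = exp (sum_N log (1 - r_N X))
                         = prod_(i >= 1) exp (- p_i X^i / i).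
    The coefficient of X^m on the left is a_(n-m) / a_n, because
    prod_N (1 - r_N X) is P / a_n with its coefficients reversed
    ([prod_roots_with_multiplicity], [coef_prod_XsubC_rev]). On the right,
    only the factors with i <= m and, in each of them, only the terms of
    degree at most m of the exponential series matter; choosing the
    exponent y_i in the i-th factor gives the sum over the partitions of m
    ([coef_prod_truncexp]).

    Power series are avoided by truncation: with [truncexp m] in place of
    exp, both sides are polynomials. They are compared without a logarithm,
    through the differential equation f' = L f that both satisfy modulo X^m
    with the same L = - sum_(1 <= i <= m) p_i X^(i-1). In characteristic 0
    this equation and the constant term determine the coefficients of f up
    to degree m ([logderiv_mod_uniq]). Solutions multiply while their
    logarithmic derivatives L add ([logderiv_mod_prod]), so the equation need
    only be checked on the single factors 1 - x X and exp (c X^i). *)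

Set Implicit Arguments.
Unset Strict Implicit.
Unset Printing Implicit Defensive.
Import GRing.Theory.

Local Open Scope ring_scope.

Lemma char0_natS_neq0 (F : fieldType) n : has_char0 F -> n.+1%:R != 0 :> F.
Proof. by move/pcharf0P->. Qed.

Section LogarithmicDerivative.
Variable F : fieldType.
Implicit Types (f g L u : {poly F}) (m : nat).

(** L is a logarithmic derivative of f up to precision X^m. The form f' = L f
    rather than L = f' / f requires no inverse modulo X^m. *)
Definition logderiv_mod m L f := 'X^m %| f^`() - L * f.

(** This is the Leibniz rule: (f g)' - (L + M) f g is
    (f' - L f) g + f (g' - M g). *)
Lemma logderiv_mod_prod m (I : Type) (s : seq I) (L f : I -> {poly F}) :
  (forall i, logderiv_mod m (L i) (f i)) ->
  logderiv_mod m (\sum_(i <- s) L i) (\prod_(i <- s) f i).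
Proof.
move=> Lf; elim: s => [|i s IHs].
  by rewrite !big_nil /logderiv_mod derivC mul0r subrr dvdp0.
rewrite !big_cons /logderiv_mod derivM.
set Ls := \sum_(j <- s) _; set fs := \prod_(j <- s) _.
have -> : (f i)^`() * fs + f i * fs^`() - (L i + Ls) * (f i * fs) =
          ((f i)^`() - L i * f i) * fs + f i * (fs^`() - Ls * fs).
  rewrite mulrBl mulrBr mulrDl !mulrA (mulrC Ls) opprD.
  by rewrite !addrA; congr (_ - _); rewrite addrAC.
by apply: dvdp_add; [apply/dvdp_mulr/Lf | apply/dvdp_mull/IHs].
Qed.

(** The coefficient of X^k in f' = L f expresses (k + 1) f_(k+1) by f_0, ...,
    f_k; dividing by k + 1 is where the characteristic matters. Derivation
    loses one degree, so precision m on the equation determines f up to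
    degree m inclusive. *)
Lemma logderiv_mod_uniq m L f g : has_char0 F ->
  logderiv_mod m L f -> logderiv_mod m L g -> f`_0 = g`_0 ->
  forall k, (k <= m)%N -> f`_k = g`_k.
Proof.
move=> char0 Lf Lg fg0; set d := f - g.
have d0 : d`_0 = 0 by rewrite coefB fg0 subrr.
have Ld j : (j < m)%N -> d^`()`_j = (L * d)`_j.
  move=> lt_jm; apply/eqP; rewrite -subr_eq0 -coefB.
  have /dvdpP[q ->] : 'X^m %| d^`() - L * d.
    by rewrite derivB mulrBr opprD addrACA -opprD dvdp_sub.
  by rewrite coefMXn lt_jm.
suff dk k : (k <= m)%N -> d`_k = 0.
  by move=> k /dk /eqP; rewrite coefB subr_eq0 => /eqP.
elim/ltn_ind: k => -[//|k] IHk lt_km; apply/eqP.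
have := Ld k lt_km; rewrite coef_deriv coefM big1 => [/eqP|i _].
  by rewrite -mulr_natr mulf_eq0 (negPf (char0_natS_neq0 _ char0)) orbF.
by rewrite IHk ?mulr0 // ?ltnS ?leq_subr // (leq_trans (leq_subr _ _)) // ltnW.
Qed.

(** The exact logarithmic derivative - x / (1 - x X) is expanded as a geometric
    series and cut at degree m; the error term is x^(m+1) X^m. *)
Lemma logderiv_mod_1BZX m (x : F) :
  logderiv_mod m (- \sum_(i < m) x ^+ i.+1 *: 'X^i) (1 - x *: 'X).
Proof.
have -> : \sum_(i < m) x ^+ i.+1 *: 'X^i = x *: \sum_(i < m) (x *: 'X) ^+ i.
  by rewrite scaler_sumr; apply: eq_bigr => i _; rewrite exprZn scalerA exprS.
rewrite /logderiv_mod derivB derivC derivZ derivX sub0r mulNr opprK.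
rewrite -scalerAl mulrC -[1 - _]opprB mulNr -subrX1 opprB scalerBr.
by rewrite addKr exprZn scalerA dvdpNr -mul_polyC dvdp_mull.
Qed.

Definition truncexp m u : {poly F} := \sum_(k < m.+1) k`!%:R^-1 *: u ^+ k.

Lemma deriv_truncexp m u : has_char0 F ->
  (truncexp m.+1 u)^`() = u^`() * truncexp m u.
Proof.
move=> char0; rewrite /truncexp big_ord_recl derivD raddf_sum.
rewrite expr0 derivZ derivC scaler0 add0r mulr_sumr; apply: eq_bigr => k _.
rewrite lift0 [LHS]derivZ deriv_exp -scalerAr -scaler_nat scalerA.
congr (_ *: _).
by rewrite factS natrM invfM mulrAC mulVf ?mul1r // char0_natS_neq0.
Qed.

(** Differentiation drops the last term of the sum, so the defect is - u' times
    that term u^m / m!, a multiple of X^m as soon as u has no constant term. *)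
Lemma logderiv_mod_truncexp m u : has_char0 F -> 'X %| u ->
  logderiv_mod m u^`() (truncexp m u).
Proof.
move=> char0 Xu; case: m => [|m]; first exact: dvd1p.
rewrite /logderiv_mod deriv_truncexp // -mulrBr.
rewrite [X in _ - X]/truncexp big_ord_recr /= -/(truncexp m u) opprD addNKr.
by rewrite dvdp_mull // dvdpNr -mul_polyC dvdp_mull // dvdp_exp2r.
Qed.

End LogarithmicDerivative.

Section GirardWaring.
Variable F : fieldType.
Implicit Types (s : seq F) (m : nat).

(** Distributing the product selects an exponent y_i <= m in each factor. This
    contributes to the degree sum_i (i + 1) y_i, and degree m is the condition
    that y be a partition of m. *)
Lemma coef_prod_truncexp m (c : 'I_m -> F) :
  (\prod_(i < m) truncexp m (c i *: 'X^(i.+1)))`_m =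
  \sum_(y in partitions m) \prod_(i < m) (c i ^+ y i / (y i)`!%:R).
Proof.
rewrite /truncexp bigA_distr_bigA coef_sum [RHS]big_mkcond /=.
apply: eq_bigr => y _; rewrite inE.
have -> : \prod_(i < m) ((y i)`!%:R^-1 *: (c i *: 'X^(i.+1)) ^+ y i) =
    (\prod_(i < m) (c i ^+ y i / (y i)`!%:R)) *:
    'X^(\sum_(i < m) i.+1 * y i) :> {poly F}.
  rewrite -prodrXr -scaler_prod; apply: eq_bigr => i _.
  by rewrite exprZn scalerA mulrC -exprM.
by rewrite coefZ coefXn eq_sym; case: eqP; rewrite (mulr1, mulr0).
Qed.

(** This is the Girard-Waring formula. By [coef_prod_truncexp] the sum over the
    partitions is the coefficient of X^m in a product of truncated exponentials
    of c_i X^(i+1), with c_i = - p_(i+1) / (i + 1); the two products then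
    satisfy the same differential equation modulo X^m. *)
Lemma coef_prod_1BZX s m : has_char0 F ->
  (\prod_(x <- s) (1 - x *: 'X))`_m =
  \sum_(y in partitions m) \prod_(i < m)
    ((-1) ^+ y i / (y i)`!%:R *
     (i.+1%:R^-1 * \sum_(x <- s) x ^+ i.+1) ^+ y i).
Proof.
move=> char0; pose c (i : 'I_m) := - (i.+1%:R^-1 * \sum_(x <- s) x ^+ i.+1).
transitivity (\prod_(i < m) truncexp m (c i *: 'X^(i.+1)))`_m; last first.
  rewrite coef_prod_truncexp; apply: eq_bigr => y _; apply: eq_bigr => i _.
  by rewrite mulrAC -exprNn.
have Xu (i : 'I_m) : 'X %| c i *: 'X^(i.+1).
  by rewrite -mul_polyC dvdp_mull // exprS dvdp_mulr.
have := logderiv_mod_prod (index_enum 'I_m)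
  (fun i => logderiv_mod_truncexp m char0 (Xu i)).
have := logderiv_mod_prod s (logderiv_mod_1BZX m).
(* Both logarithmic derivatives equal - sum_i p_(i+1) X^i: the factor i + 1 from
   differentiating X^(i+1) cancels the 1 / (i + 1) in c_i. *)
have -> : \sum_(x <- s) - \sum_(i < m) x ^+ i.+1 *: 'X^i =
    \sum_(i < m) (c i *: 'X^(i.+1))^`() :> {poly F}.
  rewrite sumrN exchange_big -sumrN; apply: eq_bigr => i _ /=.
  rewrite -scaler_suml derivZ derivXn /= -scaler_nat scalerA -scaleNr.
  by rewrite mulNr mulrAC mulVf ?mul1r // char0_natS_neq0.
move=> Ls Lc; apply: (logderiv_mod_uniq char0 Ls Lc) => //.
(* The constant terms are both 1. *)
rewrite -!horner_coef0 !horner_prod !big1 // => [i _|x _].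
  rewrite /truncexp horner_sum big_ord_recl big1 ?addr0 => [|k _].
    by rewrite hornerZ expr0 hornerC fact0 invr1 mulr1.
  by rewrite hornerZ horner_exp hornerZ hornerXn !expr0n mulr0 expr0n mulr0.
by rewrite hornerD hornerN hornerZ hornerX hornerC mulr0 subr0.
Qed.

(** The two products are reciprocal polynomials. The induction on s compares
    X f - x f with g - x X g; the boundary cases j = 0 and k = 0 use that f and
    g have degree at most the number of factors. *)
Lemma coef_prod_XsubC_rev s j k : (j + k = size s)%N ->
  (\prod_(x <- s) ('X - x%:P))`_j = (\prod_(x <- s) (1 - x *: 'X))`_k.
Proof.
have rsize s' :
    (size (\prod_(x <- s') (1 - x *: 'X) : {poly F})%R <= (size s').+1)%N.
  elim: s' => [|x s' IHs]; first by rewrite big_nil size_poly1.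
  rewrite big_cons mulrBl mul1r (leq_trans (size_polyD _ _)) // geq_max.
  rewrite (leqW IHs) size_polyN -scalerAl (leq_trans (size_scale_leq _ _)) //.
  by rewrite (leq_trans (size_polyMleq _ _)) // size_polyX.
elim: s j k => [|x s IHs] j k /= jk.
  by move: jk; rewrite !big_nil; case: j k => [|j] [|k].
rewrite !big_cons !mulrBl mul1r !coefB coefXM coefCM -scalerAl coefZ coefXM.
case: j k jk => [|j] [|k] //= [jk].
- by rewrite [X in _ = X - _]nth_default -?jk ?(IHs 0%N k) // jk rsize.
- rewrite addn0 in jk; rewrite mulr0 (IHs j 0%N) ?addn0 //.
  by rewrite [X in _ * X]nth_default ?mulr0 // size_prod_XsubC jk.
- by rewrite (IHs j k.+1) // (IHs j.+1 k) // addSnnS.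
Qed.

End GirardWaring.

(** Over an algebraically closed field P splits along some list of roots. The
    multiplicities fix that list up to a permutation, hence it agrees with r
    inside the product. *)
Lemma prod_roots_with_multiplicity (F : closedFieldType) n (P : {poly F})
    (r : n.-tuple F) :
  P != 0 -> roots_with_multiplicity P r ->
  P = lead_coef P *: \prod_(x <- r) ('X - x%:P).
Proof.
move=> P0 rP; have [s Ps] := closed_field_poly_normal P.
rewrite {1}Ps; congr (_ *: _); apply: perm_big.
rewrite perm_sym; apply/allP => x _ /=; rewrite rP Ps.
by rewrite -mul_polyC mupMr ?mu_prod_XsubC // rootC lead_coef_eq0.
Qed.

Theorem theorem4p1 (R : realType) (n : nat) (P : {poly R[i]})
    (degP : size P = n.+1) (r : n.-tuple R[i])
    (rP : roots_with_multiplicity P r) (m : nat) (le_mn : (m <= n)%N) :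
  P`_(n - m) / P`_n =
  \sum_(y in partitions m) \prod_(i < m)
    ((-1) ^+ y i / (y i)`!%:R *
     (i.+1%:R^-1 * \sum_(N < n) tnth r N ^+ i.+1) ^+ y i).
Proof.
have P0 : P != 0 by rewrite -size_poly_gt0 degP.
have lcP : lead_coef P = P`_n by rewrite lead_coefE degP.
have Pn0 : P`_n != 0 by rewrite -lcP lead_coef_eq0.
rewrite {1}(prod_roots_with_multiplicity P0 rP) lcP coefZ mulrAC mulfV // mul1r.
rewrite (@coef_prod_XsubC_rev _ _ _ m) ?subnK ?size_tuple //.
rewrite coef_prod_1BZX; last exact: Num.Theory.pchar_num.
apply: eq_bigr => y _; apply: eq_bigr => i _.
by rewrite big_tuple.
Qed.
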